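(* Let $A\in\mathbb{R}^{m\times n}$ and $b\in\mathbb{R}^m$ be partitioned as $$A=[A_1,A_2,\dots,A_c],\qquad A_i=\mathrm{col}(A_{i1},\dots,A_{ic_i}),\qquad b=\sum_{i=1}^c b_i,\qquad b_i=\mathrm{col}(b_{i1},\dots,b_{ic_i}),$$ with $A_i\in\mathbb{R}^{m\times n_i}$, $A_{ij}\in\mathbb{R}^{m_{ij}\times n_i}$, $b_i\in\mathbb{R}^m$, $b_{ij}\in\mathbb{R}^{m_{ij}}$, $\sum_{i=1}^c n_i=n$, and $\sum_{j=1}^{c_i}m_{ij}=m$ for every $i\in\{1,\dots,c\}$. Suppose that the cluster graph $\mathbb{G}$ is undirected and connected and that, for every $i\in\{1,\dots,c\}$, the graph $\mathbb{G}_i$ is undirected and connected. Consider the dynamics, for all $i\in\{1,\dots,c\}$, $j\in\{1,\dots,c_i\}$ and $t\ge0$, $$\dot x_{ij}=-\Big(A_{ij}^Ty_{ij}-\sum_{i_k\in\mathcal{N}_{ij}}(z_{ij}-z_{ik})\Big)-\sum_{i_k\in\mathcal{N}_{ij}}(x_{ij}-x_{ik}),$$ $$\dot\xi_{ij}=-\sum_{k\in\mathcal{N}_i}(y_{ij}-E_{ij}\bar y_k),\qquad y_{ij}=\xi_{ij}+A_{ij}x_{ij}-b_{ij},$$ $$\dot z_{ij}=A_{ij}^Ty_{ij}-\sum_{i_k\in\mathcal{N}_{ij}}(z_{ij}-z_{ik}),$$ with states $x_{ij},z_{ij}\in\mathbb{R}^{n_i}$, $\xi_{ij}\in\mathbb{R}^{m_{ij}}$,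 where $\bar y_k=\mathrm{col}(y_{k1},\dots,y_{kc_k})\in\mathbb{R}^m$, with initial values $\xi_{ij}(0)=0$ for all $i,j$ and arbitrary initial values $x_{ij}(0),z_{ij}(0)$. Then every $x_{ij}(t)$ converges exponentially, as $t\to\infty$, to a constant vector $x^*_{ij}\in\mathbb{R}^{n_i}$, and these vectors satisfy: (i) $x^*_{i1}=x^*_{i2}=\dots=x^*_{ic_i}=:x^*_i$ for every $i\in\{1,\dots,c\}$; (ii) $A_i^T\sum_{k=1}^c(A_kx^*_k-b_k)=0$ for every $i\in\{1,\dots,c\}$; so that $x^*=\mathrm{col}(x^*_1,\dots,x^*_c)$ is a least square solution of $Ax=b$. Moreover, $x^*$ is an exact solution of $Ax=b$ (i.e. $Ax^*=b$) if and only if $\lim_{t\to\infty}\hat y(t)=0$, where $\hat y=\mathrm{col}(\bar y_1,\dots,\bar y_c)$.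
   Context: The network is double-layered: there are $c$ clusters, and cluster $i$ consists of $c_i$ agents $i_1,\dots,i_{c_i}$. $\mathbb{G}$ is a graph on the set of clusters $\{1,\dots,c\}$, and $\mathcal{N}_i$ is the set of neighbors of cluster $i$ in $\mathbb{G}$. For each $i$, $\mathbb{G}_i$ is a graph on the agents $\{i_1,\dots,i_{c_i}\}$ of cluster $i$, and $\mathcal{N}_{ij}$ is the set of neighbors $i_k$ of agent $i_j$ in $\mathbb{G}_i$. Edges are unweighted. The matrices $E_{ij}\in\mathbb{R}^{m_{ij}\times m}$ form a row partition of the identity: $\mathrm{col}(E_{i1},\dots,E_{ic_i})=I_m$ for each $i$. $\mathrm{col}(\cdot)$ denotes the column stack of blocks. A least square solution of $Ax=b$ is a minimizer of $\|Ax-b\|^2$ over $x\in\mathbb{R}^n$ (Euclidean norm), equivalently a vector $x^*$ with $A^T(Ax^*-b)=0$. ''$x(t)$ converges exponentially to $x^*$'' means that there exist constants $C\ge 0$ and $\alpha>0$ with $\|x(t)-x^*\|\le Ce^{-\alpha t}$ for all $t\ge0$. The limits may depend on the initial values. *)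

(* Defs.v *)
From HB Require Import structures.
From mathcomp Require Export all_boot all_order all_algebra.
From mathcomp Require Export all_classical all_reals all_analysis.

Set Implicit Arguments.
Unset Strict Implicit.
Unset Printing Implicit Defensive.

Export Order.TTheory GRing.Theory Num.Theory.
Export numFieldNormedType.Exports.

Local Open Scope classical_set_scope.
Local Open Scope ring_scope.

(* MathComp's mxcol / mxrow have the literal sum of the block sizes as height /
   width; these casts let the total be a given number (the same [m] for the
   block decompositions of all clusters). *)
Definition colm (R : Type) (k m q : nat) (p : 'I_k -> nat)
    (e : (\sum_(j < k) p j)%N = m) (B : forall j, 'M[R]_(p j, q)) : 'M[R]_(m, q) :=
  castmx (e, erefl q) (\mxcol_(j < k) B j).

Definition rowm (R : Type) (k m q : nat) (p : 'I_k -> nat)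
    (e : (\sum_(j < k) p j)%N = q) (B : forall j, 'M[R]_(m, p j)) : 'M[R]_(m, q) :=
  castmx (erefl m, e) (\mxrow_(j < k) B j).

Definition undirected (T : finType) (g : rel T) : Prop := symmetric g.

Definition connected_graph (T : finType) (g : rel T) : Prop :=
  forall u v : T, connect g u v.

(* The library norm on matrices is the sup norm. *)
Definition enorm (R : realType) (k : nat) (v : 'cV[R]_k) : R :=
  Num.sqrt (\sum_(r < k) v r 0 ^+ 2).

Definition least_square_solution (R : realType) (m n : nat)
    (A : 'M[R]_(m, n)) (b : 'cV[R]_m) (x : 'cV[R]_n) : Prop :=
  forall x' : 'cV[R]_n, enorm (A *m x - b) ^+ 2 <= enorm (A *m x' - b) ^+ 2.

Definition converges_exponentially (R : realType) (k : nat)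
    (f : R -> 'cV[R]_k) (l : 'cV[R]_k) : Prop :=
  exists C alpha : R, [/\ 0 <= C, 0 < alpha &
    forall t : R, 0 <= t -> enorm (f t - l) <= C * expR (- alpha * t)].

(* [f] has derivative [df t] at every [t >= 0], as a function on [0, +oo[:
   the derivative at 0 is one-sided, so values at negative times are
   irrelevant. *)
Definition derivative_on_nonneg (R : realType) (k : nat)
    (f df : R -> 'cV[R]_k) : Prop :=
  (forall t : R, 0 < t -> is_derive t 1 f (df t)) /\
  (h^-1 *: (f h - f 0) @[h --> 0^'+] --> df 0).

(* Main.v *)
Require Import Defs.
From mathcomp Require Import ring lra.

(** Put w = x + z. Since xi(0) = 0 and the cluster Laplacian is B^T B for an
    incidence matrix B, one can write xi = - B^T zeta with zeta' = B y. With
    L = C^T C the Laplacian inside the clusters, the state v = (x, w, zeta)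
    satisfies
      x' = - D^T y + L w - 2 L x,   w' = - L x,   zeta' = B y,
      y = D x - B^T zeta - b,
    a linear system v' = M v + beta with v . M v = - |y|^2 - 2 |C x|^2 when
    b = 0. A small perturbation of |v|^2 has derivative at most
    - delta |M v|^2; this implies ker M and im M are complementary and gives
    exponential convergence to an equilibrium as soon as beta is in im M. The
    latter holds because u . beta = b . (D x - B^T zeta), for u = (x, w, zeta),
    which vanishes whenever M^T u = 0 by the dissipation identity. At an
    equilibrium C x = 0, B y = 0 and D^T y = L w: summing over the agents of a
    cluster and over the clusters yields the normal equations. *)

Set Implicit Arguments.
Unset Strict Implicit.
Unset Printing Implicit Defensive.

Local Open Scope classical_set_scope.
Local Open Scope ring_scope.

(** * Derivatives on the half-line *)

Section HalfLineDerivatives.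
Variable R : realType.
Implicit Types f g df dg : R -> R.

(* At 0 only right-continuity is retained, which is all that the comparison
   argument of derives_le_decay needs. *)
Definition derives f df : Prop :=
  (forall t : R, 0 < t -> is_derive t 1 f (df t)) /\ f h @[h --> 0^'+] --> f 0.

Lemma derives_eq f df dg :
  derives f df -> (forall t : R, 0 < t -> df t = dg t) -> derives f dg.
Proof. by case=> hf f0 e; split=> // t t0; rewrite -e //; exact: hf. Qed.

Lemma derives_cst (a : R) : derives (fun=> a) (fun=> 0).
Proof. by split=> [t _|]; [exact: is_derive_cst|exact: cvg_cst]. Qed.

Lemma derivesD f g df dg : derives f df -> derives g dg ->
  derives (fun t => f t + g t) (fun t => df t + dg t).
Proof.
move=> [hf f0] [hg g0]; split=> [t t0|]; last exact: cvgD.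
by apply: is_deriveD; [exact: hf|exact: hg].
Qed.

Lemma derivesM f g df dg : derives f df -> derives g dg ->
  derives (fun t => f t * g t) (fun t => f t * dg t + g t * df t).
Proof.
move=> [hf f0] [hg g0]; split=> [t t0|]; last exact: cvgM.
by apply: is_deriveM; [exact: hf|exact: hg].
Qed.

Lemma derivesZ a f df : derives f df ->
  derives (fun t => a * f t) (fun t => a * df t).
Proof.
move=> hf; apply: derives_eq (derivesM (derives_cst a) hf) _ => t _ /=.
by rewrite mulr0 addr0.
Qed.

Lemma derives_sum (I : Type) (r : seq I) (P : pred I) (F dF : I -> R -> R) :
  (forall i, P i -> derives (F i) (dF i)) ->
  derives (fun t => \sum_(i <- r | P i) F i t)
          (fun t => \sum_(i <- r | P i) dF i t).
Proof.
move=> h; elim: r => [|i r ih].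
  rewrite (_ : (fun t => _) = fun=> 0); last by apply/funext => t; rewrite big_nil.
  by apply: derives_eq (derives_cst 0) _ => t _; rewrite big_nil.
rewrite (_ : (fun t => \sum_(j <- i :: r | P j) F j t) = fun t =>
   (if P i then F i t else 0) + \sum_(j <- r | P j) F j t); last first.
  by apply/funext => t; rewrite big_cons; case: ifP; rewrite ?add0r.
have hi : derives (fun t => if P i then F i t else 0)
                  (fun t => if P i then dF i t else 0).
  by case e: (P i); [exact: h|exact: derives_cst].
apply: derives_eq (derivesD hi ih) _ => t _.
by rewrite big_cons; case: ifP; rewrite ?add0r.
Qed.

(** Gronwall's inequality: [f t * expR (a * t)] has nonpositive derivative for positive [t], and
    right-continuity at 0 extends the comparison to the endpoint. *)
Lemma derives_le_decay f df (a : R) : derives f df ->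
  (forall t : R, 0 < t -> df t <= - a * f t) ->
  forall t : R, 0 <= t -> f t <= f 0 * expR (- a * t).
Proof.
move=> [hf f0] hle t t0.
pose g t := f t * expR (a * t).
have dE (s : R) : is_derive s 1 (fun u : R => expR (a * u)) (a * expR (a * s)).
  have -> : (fun u : R => expR (a * u)) = expR \o (fun u => a * u) by [].
  have h1 : is_derive s 1 (fun u : R => a * u) a.
    have := is_deriveZ a (is_derive_id s 1).
    by rewrite /GRing.scale /= mulr1.
  by apply: is_derive_eq; rewrite /GRing.scale /= mulrC.
have hg (s : R) : 0 < s ->
    is_derive s 1 g (f s * (a * expR (a * s)) + expR (a * s) * df s).
  by move=> s0; have := @is_deriveM _ _ f _ s 1 _ _ (hf s s0) (dE s).
have gt_ : g t <= g 0.
  apply: (@ler0_derive1_nincry _ g 0) => //.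
  - by move=> s; rewrite in_itv/= andbT => s0; have [] := hg s s0.
  - move=> s; rewrite in_itv/= andbT => s0.
    rewrite derive1E (@derive_val _ _ _ _ _ _ _ (hg s s0)).
    have := hle s s0; have := expR_gt0 (a * s).
    set e := expR _ => e0 h.
    rewrite (_ : _ + _ = e * (df s + a * f s)); last by ring.
    by rewrite pmulr_rle0 //; lra.
  - apply/continuous_within_itvcyP; split.
      move=> s; rewrite in_itv/= andbT => s0.
      by have [/derivable1_diffP/differentiable_continuous] := hg s s0.
    apply: cvgM => //; apply: cvg_at_right_filter.
    by have [/derivable1_diffP/differentiable_continuous] := dE 0.
move: gt_; rewrite /g mulr0 expR0 mulr1 => h.
by rewrite mulNr expRN ler_pdivlMr ?expR_gt0.
Qed.

Lemma derives0_cst f : derives f (fun=> 0) -> forall t : R, 0 <= t -> f t = f 0.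
Proof.
move=> hf t t0; apply/eqP; rewrite eq_le; apply/andP; split.
  have := @derives_le_decay _ _ 0 hf; rewrite oppr0 => /(_ _ t t0).
  by rewrite mul0r expR0 mulr1; apply=> s _; rewrite mul0r.
have := @derives_le_decay _ _ 0 (derivesZ (-1) hf); rewrite oppr0 => /(_ _ t t0).
rewrite mul0r expR0 mulr1 !mulN1r lerN2; apply=> s _.
by rewrite mul0r oppr0.
Qed.

Definition vderives k (f df : R -> 'cV[R]_k) : Prop :=
  forall a, derives (fun t => f t a 0) (fun t => df t a 0).

Lemma vderives_eq k (f df dg : R -> 'cV[R]_k) :
  vderives f df -> (forall t : R, 0 < t -> df t = dg t) -> vderives f dg.
Proof. by move=> h e a; apply: derives_eq (h a) _ => t t0; rewrite e. Qed.

Lemma vderives_cst k (u : 'cV[R]_k) : vderives (fun=> u) (fun=> 0).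
Proof. by move=> a; apply: derives_eq (derives_cst _) _ => t _; rewrite mxE. Qed.

Lemma vderivesD k (f g df dg : R -> 'cV[R]_k) : vderives f df -> vderives g dg ->
  vderives (fun t => f t + g t) (fun t => df t + dg t).
Proof.
move=> hf hg a; rewrite (_ : (fun t => _) = fun t => f t a 0 + g t a 0); last first.
  by apply/funext => t; rewrite mxE.
by apply: derives_eq (derivesD (hf a) (hg a)) _ => t _; rewrite mxE.
Qed.

Lemma vderives_sum k (I : finType) (f df : I -> R -> 'cV[R]_k) :
  (forall i, vderives (f i) (df i)) ->
  vderives (fun t => \sum_i f i t) (fun t => \sum_i df i t).
Proof.
move=> h a; rewrite (_ : (fun t => _) = fun t => \sum_i f i t a 0); last first.
  by apply/funext => t; rewrite summxE.
apply: derives_eq (derives_sum _ (fun i _ => h i a)) _ => t _.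
by rewrite summxE.
Qed.

Lemma vderives_mul k l (M : 'M[R]_(l, k)) (f df : R -> 'cV[R]_k) :
  vderives f df -> vderives (fun t => M *m f t) (fun t => M *m df t).
Proof.
move=> hf a; rewrite (_ : (fun t => _) = fun t => \sum_b M a b * f t b 0); last first.
  by apply/funext => t; rewrite mxE.
apply: derives_eq (derives_sum _ _) _ => [b _|t _]; first exact: derivesZ (hf b).
by rewrite mxE.
Qed.

Lemma vderives_col_mx k l (f df : R -> 'cV[R]_k) (g dg : R -> 'cV[R]_l) :
  vderives f df -> vderives g dg ->
  vderives (fun t => col_mx (f t) (g t)) (fun t => col_mx (df t) (dg t)).
Proof.
move=> hf hg a; case: (split_ordP a) => i ->.
  rewrite (_ : (fun t => _) = fun t => f t i 0); last first.
    by apply/funext => t; rewrite col_mxEu.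
  by apply: derives_eq (hf i) _ => t _; rewrite col_mxEu.
rewrite (_ : (fun t => _) = fun t => g t i 0); last first.
  by apply/funext => t; rewrite col_mxEd.
by apply: derives_eq (hg i) _ => t _; rewrite col_mxEd.
Qed.

Lemma vderives0_cst k (f : R -> 'cV[R]_k) : vderives f (fun=> 0) ->
  forall t : R, 0 <= t -> f t = f 0.
Proof.
move=> hf t t0; apply/matrixP => a j; rewrite ord1.
by apply: (@derives0_cst (fun t => f t a 0)) => //; apply: derives_eq (hf a) _ => s _; rewrite mxE.
Qed.

Lemma derivative_on_nonneg_vderives k (f df : R -> 'cV[R]_k) :
  derivative_on_nonneg f df -> vderives f df.
Proof.
move=> [hf hf0] a; split=> [t t0|].
  have [hd hv] := hf t t0; split; first by have /derivable_mxP := hd; exact.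
  by rewrite -hv derive_mx // mxE.
(* Right-continuity at 0 is recovered from the convergent difference quotient, multiplied back by
   [h], which tends to 0. *)
have h0 : h *: (h^-1 *: (f h - f 0)) + f 0 @[h --> 0^'+] --> 0 *: df 0 + f 0.
  apply: cvgD; last exact: cvg_cst.
  by apply: cvgZ => //; apply: cvg_at_right_filter; exact: cvg_id.
have h1 : f h @[h --> 0^'+] --> f 0.
  rewrite scale0r add0r in h0; apply: cvg_trans h0; apply: near_eq_cvg.
  near=> h; rewrite scalerA divff ?scale1r ?subrK //.
exact: (cvg_comp _ _ h1 (@coord_continuous _ _ _ a 0 (f 0))).
Unshelve. all: by end_near. Qed.

End HalfLineDerivatives.

(** * Linear systems with a weak Lyapunov function *)

Section DotProduct.
Variable R : realType.

Definition dot k (u v : 'cV[R]_k) : R := \sum_a u a 0 * v a 0.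

Lemma dotC k (u v : 'cV[R]_k) : dot u v = dot v u.
Proof. by apply: eq_bigr => a _; rewrite mulrC. Qed.

Lemma dotDl k (u v w : 'cV[R]_k) : dot (u + v) w = dot u w + dot v w.
Proof. by rewrite /dot -big_split; apply: eq_bigr => a _; rewrite mxE mulrDl. Qed.

Lemma dotZl k s (u v : 'cV[R]_k) : dot (s *: u) v = s * dot u v.
Proof. by rewrite /dot mulr_sumr; apply: eq_bigr => a _; rewrite mxE mulrA. Qed.

Lemma dotNl k (u v : 'cV[R]_k) : dot (- u) v = - dot u v.
Proof. by rewrite -scaleN1r dotZl mulN1r. Qed.

Lemma dotDr k (u v w : 'cV[R]_k) : dot w (u + v) = dot w u + dot w v.
Proof. by rewrite dotC dotDl !(dotC w). Qed.

Lemma dotZr k s (u v : 'cV[R]_k) : dot u (s *: v) = s * dot u v.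
Proof. by rewrite dotC dotZl dotC. Qed.

Lemma dotNr k (u v : 'cV[R]_k) : dot u (- v) = - dot u v.
Proof. by rewrite dotC dotNl dotC. Qed.

Definition dotE := (dotDl, dotDr, dotZl, dotZr, dotNl, dotNr).

Lemma dot0l k (v : 'cV[R]_k) : dot 0 v = 0.
Proof. by rewrite -(scale0r 0) dotZl mul0r. Qed.

Lemma dot_col_mx k l (u v : 'cV[R]_k) (u' v' : 'cV[R]_l) :
  dot (col_mx u u') (col_mx v v') = dot u v + dot u' v'.
Proof.
rewrite /dot big_split_ord; congr (_ + _); apply: eq_bigr => a _.
  by rewrite !col_mxEu.
by rewrite !col_mxEd.
Qed.

Lemma dot_mulr k l (M : 'M[R]_(l, k)) u v : dot u (M *m v) = dot (M^T *m u) v.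
Proof.
rewrite /dot; under eq_bigr do rewrite mxE mulr_sumr.
rewrite exchange_big; apply: eq_bigr => b _; rewrite mxE mulr_suml.
by apply: eq_bigr => a _; rewrite mxE mulrCA mulrA.
Qed.

Lemma dot_mull k l (M : 'M[R]_(l, k)) u v : dot (M *m v) u = dot v (M^T *m u).
Proof. by rewrite dotC dot_mulr dotC. Qed.

Lemma dot_ge0 k (u : 'cV[R]_k) : 0 <= dot u u.
Proof. by apply: sumr_ge0 => a _; rewrite -expr2 sqr_ge0. Qed.

Lemma sqr_entry_le_dot k (u : 'cV[R]_k) a : u a 0 ^+ 2 <= dot u u.
Proof.
rewrite /dot (bigD1 a) //= -expr2 lerDl.
by apply: sumr_ge0 => b _; rewrite -expr2 sqr_ge0.
Qed.

Lemma dot_le0_eq0 k (u : 'cV[R]_k) : dot u u <= 0 -> u = 0.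
Proof.
move=> h; apply/matrixP => a j; rewrite ord1 mxE; apply/eqP.
by rewrite -sqrf_eq0 eq_le sqr_ge0 andbT (le_trans (sqr_entry_le_dot u a)).
Qed.

Lemma dot_CauchySchwarz k (u v : 'cV[R]_k) : dot u v ^+ 2 <= dot u u * dot v v.
Proof.
have := dot_ge0 u; rewrite le_eqVlt => /predU1P[u0|u0].
  by rewrite (dot_le0_eq0 (u := u)) -?u0 // !dot0l mul0r expr0n.
(* This vector has squared norm [dot u u * (dot u u * dot v v - dot u v ^+ 2)]. *)
have := dot_ge0 (dot u u *: v - dot u v *: u).
rewrite !dotE (dotC v u) => h.
rewrite -subr_ge0 -(pmulr_rge0 _ u0); apply: le_trans h _.
by rewrite le_eqVlt; apply/orP; left; apply/eqP; ring.
Qed.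

Lemma dot_mul_bounded k l (M : 'M[R]_(l, k)) :
  exists2 K, 0 < K & forall v, dot (M *m v) (M *m v) <= K * dot v v.
Proof.
(* The squared Frobenius norm works, by Cauchy-Schwarz on each row; the added 1 keeps the constant
   positive when [M] is zero. *)
exists (\sum_a dot (row a M)^T (row a M)^T + 1).
  by apply: ltr_wpDl => //; apply: sumr_ge0 => a _; exact: dot_ge0.
move=> v; rewrite mulrDl mul1r; apply: ler_wpDr; first exact: dot_ge0.
rewrite {1}/dot mulr_suml; apply: ler_sum => a _.
apply: le_trans (dot_CauchySchwarz _ _); rewrite -expr2 le_eqVlt; apply/orP.
left; apply/eqP; congr (_ ^+ 2); rewrite mxE.
by apply: eq_bigr => b _; rewrite !mxE.
Qed.

Lemma derives_dot k (f g df dg : R -> 'cV[R]_k) :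
  vderives f df -> vderives g dg ->
  derives (fun t => dot (f t) (g t)) (fun t => dot (df t) (g t) + dot (f t) (dg t)).
Proof.
move=> hf hg; apply: derives_eq.
  by apply: derives_sum => a _; apply: derivesM; [exact: hf|exact: hg].
move=> t _ /=; rewrite /dot -big_split; apply: eq_bigr => a _ /=; ring.
Qed.

End DotProduct.

Section LinearStability.
Variable R : realType.

(** The columns of [cokermx S] are killed by [S], hence by [B], which is the criterion for inclusion
    of row spaces. *)
Lemma mx_factor (F : fieldType) m n p (S : 'M[F]_(m, n)) (B : 'M[F]_(p, n)) :
  (forall v : 'cV_n, S *m v = 0 -> B *m v = 0) -> exists K, B = K *m S.
Proof.
move=> h; apply/submxP; rewrite submxE; apply/eqP/matrixP => i j.
have /matrixP/(_ i 0) : B *m col j (cokermx S) = 0.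
  by apply: h; rewrite colE mulmxA mulmx_coker mul0mx.
by rewrite colE mulmxA -colE mxE => ->; rewrite !mxE.
Qed.

(** Equal kernels give [M] and [M *m M] the same row space, hence the same rank, hence the same
    column space. *)
Lemma sqr_mx_factor (F : fieldType) N (M : 'M[F]_N) :
  (forall q : 'cV_N, M *m (M *m q) = 0 -> M *m q = 0) ->
  (exists P, M = M *m M *m P) /\ (exists P, M = P *m (M *m M)).
Proof.
move=> h.
have [P PMM] : exists P, M = P *m (M *m M).
  by apply: mx_factor => v; rewrite -mulmxA; exact: h.
split; last by exists P.
have : (M^T <= M^T *m M^T)%MS.
  rewrite -(geq_leqif (mxrank_leqif_sup (submxMl _ _))) -trmx_mul !mxrank_tr.
  by rewrite {1}PMM mxrankS ?submxMl.
move=> /submxP[S /(congr1 trmx)]; rewrite !trmx_mul !trmxK => e.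
by exists S^T.
Qed.

(** The Lyapunov function [dot v (Q *m v)] is equivalent to the squared norm, but its dissipation
    controls only [M *m v]. Decay therefore takes place on the image of [M], and the kernel
    component of the initial value survives in the limit. *)
Lemma linear_ode_converges N (M Q : 'M[R]_N) (beta theta0 : 'cV[R]_N)
    (c1 c2 delta : R) (theta : R -> 'cV[R]_N) :
  0 < c1 -> 0 < c2 -> 0 < delta ->
  (forall v, c1 * dot v v <= dot v (Q *m v)) ->
  (forall v, dot v (Q *m v) <= c2 * dot v v) ->
  (forall v, dot (M *m v) (Q *m v) + dot v (Q *m (M *m v)) <=
             - delta * dot (M *m v) (M *m v)) ->
  M *m theta0 + beta = 0 ->
  vderives theta (fun t => M *m theta t + beta) ->
  exists thetas C alpha, [/\ 0 <= C, 0 < alpha, M *m thetas + beta = 0 &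
    forall t : R, 0 <= t ->
      dot (theta t - thetas) (theta t - thetas) <= C * expR (- alpha * t)].
Proof.
move=> c10 c20 delta0 Vge Vle Vdec h0 hth.
(* If d = M q is in the kernel, the decay inequality at q + s d bounds
   2 s V(d) uniformly in s, which forces V(d) <= 0. *)
have ker_im (q : 'cV_N) : M *m (M *m q) = 0 -> M *m q = 0.
  move=> hq; set d := M *m q; apply: dot_le0_eq0.
  suff E0 : dot d (Q *m d) <= 0.
    by have := Vge d; have := dot_ge0 d; nra.
  rewrite leNgt; apply/negP => Epos.
  set E := dot d (Q *m d) in Epos.
  set P := dot d (Q *m q) + dot q (Q *m d).
  (* With this multiple of [d] the left side [P + 2 s E] equals 1, while the right side is at most
     0. *)
  have := Vdec (q + ((1 - P) / (2 * E)) *: d).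
  rewrite !mulmxDr -!scalemxAr hq -/d scaler0 mulmx0 scaler0 !addr0 !dotE -/E.
  set s := (1 - P) / (2 * E).
  have sE : s * (2 * E) = 1 - P by rewrite divfK // mulf_neq0 // gt_eqF.
  have := dot_ge0 d; rewrite /P in sE *; nra.
(* Hence the space splits as im M + ker M, with projections M P and 1 - M P;
   the kernel part kk of theta - theta0 is constant and the image part r
   decays. *)
have [[P MMP] [P' PMM]] := sqr_mx_factor ker_im.
(* By [MMP], [M] kills the columns of [M *m (P *m M - 1%:M)]; [ker_im] then makes these columns
   zero. *)
have MPM : M *m P *m M = M.
  apply/eqP; rewrite -subr_eq0; apply/eqP/matrixP => i j.
  have -> : M *m P *m M - M = M *m (P *m M - 1%:M).
    by rewrite mulmxBr mulmx1 mulmxA.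
  suff e : col j (M *m (P *m M - 1%:M)) = 0.
    by have /matrixP/(_ i 0) := e; rewrite [in RHS]mxE mxE => ->; rewrite mxE.
  rewrite colE -mulmxA; apply: ker_im.
  by rewrite !mulmxA mulmxBr mulmx1 !mulmxA -MMP subrr mul0mx.
have [K K0 hK] := dot_mul_bounded P'.
pose r (t : R) := M *m P *m (theta t - theta0).
have hth1 : vderives (fun t => theta t - theta0) (fun t => M *m (theta t - theta0)).
  apply: vderives_eq (vderivesD hth (vderives_cst (- theta0))) _ => t _.
  by rewrite addr0 mulmxBr -[in LHS](subrK (M *m theta0) (M *m theta t)) -addrA h0 addr0.
have Mr (t : R) : M *m r t = M *m (theta t - theta0) by rewrite /r !mulmxA -MMP.
have hr : vderives r (fun t => M *m r t).
  by apply: vderives_eq (vderives_mul (M *m P) hth1) _ => t _; rewrite Mr mulmxA MPM.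
pose kk (t : R) := theta t - theta0 - r t.
have hkk : vderives kk (fun=> 0).
  have -> : kk = fun t => (theta t - theta0) + (- 1%:M) *m r t.
    by apply/funext => t; rewrite /kk mulNmx mul1mx.
  apply: vderives_eq (vderivesD hth1 (vderives_mul _ hr)) _ => t _.
  by rewrite Mr mulNmx mul1mx subrr.
(* As [r] lies in the image of [M], [P'] recovers it from [M *m r]. Its Lyapunov value is thus at
   most [c2 * K] times the square of [M *m r], which gives the rate. *)
exists (theta0 + kk 0), (dot (r 0) (Q *m r 0) / c1), (delta / (K * c2)).
split.
- rewrite divr_ge0 ?(ltW c10) //; apply: le_trans (Vge _).
  by rewrite mulr_ge0 ?dot_ge0 ?(ltW c10).
- by rewrite divr_gt0 ?mulr_gt0.
- rewrite mulmxDr addrAC h0 add0r /kk mulmxBr Mr mulmxBr subrr //.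
move=> t t0.
have -> : theta t - (theta0 + kk 0) = r t.
  by rewrite opprD addrA -(vderives0_cst hkk t0) /kk opprB addrCA subrr addr0.
have hV := derives_dot hr (vderives_mul Q hr).
have := derives_le_decay (a := delta / (K * c2)) hV _ t0.
have hdec (s : R) : 0 < s -> dot (M *m r s) (Q *m r s) + dot (r s) (Q *m (M *m r s)) <=
    - (delta / (K * c2)) * dot (r s) (Q *m r s).
  move=> _; apply: le_trans (Vdec _) _.
  have rE : r s = P' *m (M *m r s) by rewrite {1}/r {1}PMM !mulmxA -/(r s).
  have h1 : dot (r s) (r s) <= K * dot (M *m r s) (M *m r s).
    by rewrite {1 2}rE.
  have h2 : dot (r s) (Q *m r s) <= c2 * (K * dot (M *m r s) (M *m r s)).
    by apply: le_trans (Vle _) _; rewrite ler_pM2l.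
  rewrite !mulNr lerN2 mulrAC ler_pdivrMr ?mulr_gt0 // -mulrA ler_pM2l //.
  by apply: le_trans h2 _; rewrite le_eqVlt; apply/orP; left; apply/eqP; ring.
move=> /(_ hdec) h.
rewrite -(ler_pM2l c10); apply: le_trans (Vge _) _; apply: le_trans h _.
by rewrite mulrA (mulrC c1) divfK ?gt_eqF.
Qed.

End LinearStability.

(** * The primal-dual system *)

Section PrimalDualSystem.
Variable R : realType.

(** If the Gram matrix kills [v], then [B *m v] has zero norm, so both matrices have the same
    kernel. *)
Lemma gram_mx_factor m n (B : 'M[R]_(m, n)) : exists K, B = K *m (B^T *m B).
Proof.
apply: mx_factor => v h; apply: dot_le0_eq0.
by rewrite dot_mull mulmxA h dotC dot0l.
Qed.

Variables (q p e l : nat).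
Variables (D : 'M[R]_(p, q)) (C : 'M[R]_(l, q)) (B : 'M[R]_(e, p)).
Local Notation L := (C^T *m C).

Let M : 'M[R]_(q + (q + e)) :=
  col_mx (row_mx (- (D^T *m D) - 2 *: L) (row_mx L (D^T *m B^T)))
    (col_mx (row_mx (- L) 0) (row_mx (B *m D) (row_mx 0 (- (B *m B^T))))).

Let ME (x w : 'cV_q) (zeta : 'cV_e) y : y = D *m x - B^T *m zeta ->
  M *m col_mx x (col_mx w zeta) =
  col_mx (- (D^T *m y) + L *m w - 2 *: (L *m x)) (col_mx (- (L *m x)) (B *m y)).
Proof.
move=> ->; rewrite /M !(mul_col_mx, mul_row_col, mul0mx, addr0, add0r).
rewrite !mulmxBr !mulmxDl !mulNmx -!scalemxAl !mulmxA.
congr (col_mx _ (col_mx _ _)).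
by apply/matrixP => i j; rewrite !mxE; ring.
Qed.

(* The dissipation of |v|^2 controls y and C x but not L w; the cross term
   - 2 eps (x . L w) adds - eps |L w|^2 to the derivative, at the price of
   terms that the dissipation absorbs when eps is small. *)
Let Q (eps : R) : 'M[R]_(q + (q + e)) :=
  col_mx (row_mx 1%:M (row_mx (- eps *: L) 0))
    (col_mx (row_mx (- eps *: L) (row_mx 1%:M 0)) (row_mx 0 (row_mx 0 1%:M))).

Let QE eps (x w : 'cV_q) (zeta : 'cV_e) :
  Q eps *m col_mx x (col_mx w zeta) =
  col_mx (x - eps *: (L *m w)) (col_mx (w - eps *: (L *m x)) zeta).
Proof.
rewrite /Q !(mul_col_mx, mul_row_col, mul0mx, mul1mx, addr0, add0r).
rewrite -!scalemxAl !scaleNr; congr (col_mx _ (col_mx _ _)).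
by rewrite addrC.
Qed.

Let split_state (v : 'cV[R]_(q + (q + e))) :
  exists x w zeta, v = col_mx x (col_mx w zeta).
Proof.
by exists (usubmx v), (usubmx (dsubmx v)), (dsubmx (dsubmx v)); rewrite !vsubmxK.
Qed.

Let dot_L (x w : 'cV_q) : dot x (L *m w) = dot (L *m x) w.
Proof. by rewrite dot_mulr trmx_mul trmxK. Qed.

(** The terms pairing [x] with [L w] and [w] with [L x] cancel by symmetry of [L]; the [D] and [B]
    terms combine into [- dot y y]. *)
Let dissipation (x w : 'cV_q) (zeta : 'cV_e) y (v := col_mx x (col_mx w zeta)) :
  y = D *m x - B^T *m zeta ->
  dot v (M *m v) = - dot y y - 2 * dot (C *m x) (C *m x).
Proof.
move=> yE; have yy : dot y y = dot (D *m x) y - dot (B^T *m zeta) y.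
  by rewrite {1}yE dotDl dotNl.
rewrite /v (ME _ yE) !dot_col_mx !dotE.
have -> : dot x (D^T *m y) = dot (D *m x) y by rewrite dot_mulr trmxK.
have -> : dot zeta (B *m y) = dot (B^T *m zeta) y by rewrite dot_mulr.
have -> : dot x (L *m x) = dot (C *m x) (C *m x).
  by rewrite -mulmxA dot_mulr trmxK.
by rewrite (dotC w) -dot_L yy; ring.
Qed.

Lemma primal_dual_lyapunov : exists eps delta, [/\ 0 < delta,
  forall v, 2^-1 * dot v v <= dot v (Q eps *m v),
  forall v, dot v (Q eps *m v) <= 2 * dot v v &
  forall v, dot (M *m v) (Q eps *m v) + dot v (Q eps *m (M *m v)) <=
            - delta * dot (M *m v) (M *m v)].
Proof.
have dot_sym_L x w : dot x (L *m w) = dot w (L *m x) by rewrite dot_L dotC.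
have [kD kD0 hkD] := dot_mul_bounded D^T.
have [kC kC0 hkC] := dot_mul_bounded C^T.
have [kB kB0 hkB] := dot_mul_bounded B.
have [kL kL0 hkL] := dot_mul_bounded L.
(* The choice [eps * S = 1/2] makes [eps * (1 + kL)], [eps * kD] and [eps * (4 * kC)] all at most
   1/2: the first keeps [Q eps] close to the identity, the others let the dissipation absorb the
   cross terms. *)
pose S := 1 + kD + 4 * kC + kL.
have S0 : 0 < S by rewrite /S; lra.
pose eps := (2 * S)^-1.
have eps0 : 0 < eps by rewrite invr_gt0; lra.
have epsS : eps * (2 * S) = 1 by rewrite mulVf // gt_eqF //; lra.
have epsS' : eps * S = 2^-1 by rewrite /eps invfM -mulrA mulVf ?mulr1 ?gt_eqF.
(* [T] bounds the square of [M *m v] by a multiple of [|y|^2 + |C x|^2 + eps |L w|^2]; 13 is 12 from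
   the first block plus 1 from the second. *)
pose T := 3 * kD + kB + 13 * kC + 3 / eps.
have e3 : 0 < 3 / eps by rewrite divr_gt0.
have T0 : 0 < T by rewrite /T; lra.
pose delta := T^-1.
have delta0 : 0 < delta by rewrite invr_gt0.
have deltaT : delta * T = 1 by rewrite mulVf // gt_eqF.
have hV v : `|dot v (Q eps *m v) - dot v v| <= 2^-1 * dot v v.
  have [x [w [zeta ->]]] := split_state v.
  rewrite QE !dot_col_mx !dotE -(dot_sym_L x w).
  have h1 := dot_ge0 (x - L *m w); have h2 := dot_ge0 (x + L *m w).
  have h3 := hkL w; move: h1 h2; rewrite !dotE (dotC (L *m w) x) => h1 h2.
  have h4 := dot_ge0 x; have h5 := dot_ge0 w; have h6 := dot_ge0 zeta.
  set F := dot x (L *m w) in h1 h2 *.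
  have hF : `|2 * F| <= (1 + kL) * (dot x x + dot w w).
    rewrite ler_norml; apply/andP; split; nra.
  rewrite (_ : _ - _ = - (eps * (2 * F))); last by ring.
  rewrite normrN normrM (gtr0_norm eps0).
  apply: (@le_trans _ _ (eps * ((1 + kL) * (dot x x + dot w w)))).
    by rewrite ler_pM2l.
  rewrite mulrA; apply: (@le_trans _ _ (2^-1 * (dot x x + dot w w))).
    by apply: ler_wpM2r; rewrite ?addr_ge0 // -epsS' ler_pM2l // /S; lra.
  lra.
exists eps, delta; split => //.
- by move=> v; have := hV v; rewrite ler_norml; lra.
- by move=> v; have := hV v; have := dot_ge0 v; rewrite ler_norml; lra.
move=> v; have [x [w [zeta ->]]] := split_state v.
have [y yE] : exists y, y = D *m x - B^T *m zeta by eexists.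
have hdis := dissipation w yE; rewrite (ME _ yE) !dot_col_mx in hdis.
rewrite (ME _ yE) !QE !dot_col_mx.
have hY := hkD y; have hm := hkC (C *m x); have hB := hkB y.
rewrite mulmxA in hm.
set pp := D^T *m y in hY hdis *; set c := C *m x in hm hdis *.
set u := L *m x in hm hdis *; set l' := L *m w in hdis *.
set a1 := - pp + l' - 2 *: u in hdis *.
have e1 : dot x (L *m - u) = - dot u u by rewrite dot_L dotNr.
have e2 : dot w (L *m a1) = dot l' a1 by rewrite dot_L.
rewrite !dotE in hdis *; rewrite e1 e2 /a1 !dotE.
rewrite (dotC pp x) (dotC l' x) (dotC u x) (dotC u w) (dotC (B *m y) zeta).
rewrite (dotC l' pp) (dotC u pp) (dotC l' u).
(* [q1] and [q2] are Young inequalities, weighted so that each cross term of the derivative costs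
   only [eps * ll / 2]. [q3] to [q5] bound the square of the three-term sum [a1] by three times the
   sum of squares. *)
have q1 := dot_ge0 (2 *: pp - l'); have q2 := dot_ge0 (4 *: u - l').
have q3 := dot_ge0 (pp + l'); have q4 := dot_ge0 (l' + 2 *: u).
have q5 := dot_ge0 (pp - 2 *: u).
rewrite !dotE (dotC l' pp) in q1 q3; rewrite !dotE (dotC l' u) in q2 q4.
rewrite !dotE (dotC u pp) in q5.
have ll0 := dot_ge0 l'; have Y0 := dot_ge0 y; have c0 := dot_ge0 c.
set Y := dot y y in hY hB hdis Y0 *; set cc := dot c c in hm hdis c0 *.
set ll := dot l' l' in q1 q2 q3 q4 ll0 *; set P := dot pp pp in hY q1 q3 q5 *.
set mm := dot u u in hm q2 q4 q5 *; set bb := dot (B *m y) _ in hB *.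
set pl := dot pp l' in q1 q3 *; set ul := dot u l' in q2 q4 *.
set pu := dot pp u in q5 *.
set n := (X in _ <= - delta * X).
have hn : n <= T * (Y + cc + eps * ll).
  have -> : T * (Y + cc + eps * ll) = (3 * kD + kB) * Y + 13 * kC * cc + 3 * ll
     + ((13 * kC + 3 / eps) * Y + (3 * kD + kB + 3 / eps) * cc
     + (3 * kD + kB + 13 * kC) * (eps * ll)).
    by rewrite /T; field; rewrite gt_eqF.
  have r1 : 0 <= (13 * kC + 3 / eps) * Y by apply: mulr_ge0 => //; lra.
  have r2 : 0 <= (3 * kD + kB + 3 / eps) * cc by apply: mulr_ge0 => //; lra.
  have r3 : 0 <= (3 * kD + kB + 13 * kC) * (eps * ll).
    by apply: mulr_ge0; [lra|apply: mulr_ge0 => //; exact: ltW].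
  rewrite /n; lra.
have hdn : delta * n <= Y + cc + eps * ll.
  by rewrite -[leRHS]mul1r -deltaT -mulrA ler_pM2l.
have s1 : eps * P <= 2^-1 * Y.
  apply: (@le_trans _ _ (eps * kD * Y)); first by rewrite -mulrA ler_pM2l.
  by apply: ler_wpM2r => //; rewrite -epsS' ler_pM2l // /S; lra.
have s2 : eps * mm <= 8^-1 * cc.
  apply: (@le_trans _ _ (eps * kC * cc)); first by rewrite -mulrA ler_pM2l.
  apply: ler_wpM2r => //; suff : eps * (4 * kC) <= 2^-1 by lra.
  by rewrite -epsS' ler_pM2l // /S; lra.
have s3 : eps * pl <= eps * (P + 4^-1 * ll) by rewrite ler_pM2l //; lra.
have s4 : eps * ul <= eps * (2 * mm + 8^-1 * ll) by rewrite ler_pM2l //; lra.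
(* The derivative starts from [- 2 * Y - 4 * cc - 2 * eps * ll]; the cross terms consume at most
   [Y], [5/4 * cc] and [eps * ll]. *)
rewrite mulNr lerNr; apply: le_trans hdn _.
lra.
Qed.

Lemma primal_dual_converges (b : 'cV[R]_p) (x z : R -> 'cV[R]_q)
    (xi y : R -> 'cV[R]_p) :
  (forall t : R, 0 <= t -> y t = xi t + D *m x t - b) ->
  vderives x (fun t => - (D^T *m y t - L *m z t) - L *m x t) ->
  vderives xi (fun t => - (B^T *m B *m y t)) ->
  vderives z (fun t => D^T *m y t - L *m z t) ->
  xi 0 = 0 ->
  exists xs ys ws zs C0 alpha, [/\ C *m xs = 0, B *m ys = 0, D^T *m ys = L *m ws,
    ys = D *m xs - B^T *m zs - b &
    [/\ 0 <= C0, 0 < alpha &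
    forall t : R, 0 <= t ->
      dot (x t - xs) (x t - xs) <= C0 * expR (- alpha * t) /\
      dot (y t - ys) (y t - ys) <= C0 * expR (- alpha * t)]].
Proof.
move=> hy hx hxi hz xi0.
have [K BK] := gram_mx_factor B.
(* By [BK] this has derivative [B *m y t], so [xi + B^T zeta] is constant; the initial value
   [xi 0 = 0] makes it zero. *)
pose zeta t := - K *m xi t.
have hzeta : vderives zeta (fun t => B *m y t).
  apply: vderives_eq (vderives_mul (- K) hxi) _ => t _.
  by rewrite mulNmx mulmxN opprK mulmxA -BK.
have xiE (t : R) : 0 <= t -> xi t = - (B^T *m zeta t).
  move=> t0; apply/eqP; rewrite -subr_eq0 opprK; apply/eqP.
  have h : vderives (fun t => xi t + B^T *m zeta t) (fun=> 0).
    apply: vderives_eq (vderivesD hxi (vderives_mul B^T hzeta)) _ => s _.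
    by rewrite mulmxA addNr.
  by rewrite (vderives0_cst h t0) /zeta xi0 !mulmx0 addr0.
have yE (t : R) : 0 <= t -> y t = D *m x t - B^T *m zeta t - b.
  by move=> t0; rewrite hy // xiE // [- _ + _]addrC.
pose theta t := col_mx (x t) (col_mx (x t + z t) (zeta t)).
pose beta : 'cV[R]_(q + (q + e)) := col_mx (D^T *m b) (col_mx 0 (- (B *m b))).
have htheta : vderives theta (fun t => M *m theta t + beta).
  have h := vderives_col_mx hx (vderives_col_mx (vderivesD hx hz) hzeta).
  apply: vderives_eq h _ => t t0; rewrite (ME _ erefl) /beta !add_col_mx addr0.
  have -> : D *m x t - B^T *m zeta t = y t + b by rewrite (yE t (ltW t0)) subrK.
  rewrite !mulmxDr addrK; congr (col_mx _ (col_mx _ _)).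
    move: (D^T *m y t) (D^T *m b) (L *m z t) (L *m x t) => u1 u2 u3 u4.
    by apply/matrixP => i j; rewrite !mxE; ring.
  move: (D^T *m y t) (L *m z t) (L *m x t) => u1 u2 u3.
  by apply/matrixP => i j; rewrite !mxE; ring.
have betaE u : M^T *m u = 0 -> dot u beta = 0.
  have [x' [w' [zeta' ->]]] := split_state u => hu.
  pose y' := D *m x' - B^T *m zeta'.
  have := dissipation w' (erefl y'); rewrite dot_mulr hu dot0l => h.
  have y'0 : y' = 0.
    apply: dot_le0_eq0; have := dot_ge0 (C *m x'); lra.
  rewrite /beta !dot_col_mx dotNr !dot_mulr trmxK (dotC w') dot0l add0r.
  by rewrite -dotNl -dotDl -/y' y'0 dot0l.
(* Orthogonality of [beta] to the kernel of [M^T] becomes membership in the image of [M], so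
   [- G0^T] is an equilibrium. *)
have [G0 betaM] : exists G0, beta^T = G0 *m M^T.
  apply: mx_factor => u /betaE h; apply/matrixP => i j; rewrite !ord1 [RHS]mxE -h [LHS]mxE.
  by apply: eq_bigr => a _; rewrite mxE mulrC.
have h0 : M *m (- G0^T) + beta = 0.
  by rewrite -[beta]trmxK betaM trmx_mul trmxK mulmxN addNr.
have [eps [delta [delta0 Vge Vle Vdec]]] := primal_dual_lyapunov.
have half0 : 0 < 2^-1 :> R by rewrite invr_gt0.
have two0 : 0 < 2 :> R by [].
have [ths [C0 [alpha [C00 alpha0 Mths hconv]]]] :=
  linear_ode_converges half0 two0 delta0 Vge Vle Vdec h0 htheta.
have [xs [ws [zs thsE]]] := split_state ths.
(* The error of [y] is this matrix applied to the error of the state, so [(1 + K') * C0] serves both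
   estimates. *)
have [K' hK'0 hK'] :=
  dot_mul_bounded (row_mx D (row_mx (0 : 'M[R]_(p, q)) (- B^T))).
pose ys := D *m xs - B^T *m zs - b.
exists xs, ys, ws, zs, ((1 + K') * C0), alpha.
have : col_mx (- (D^T *m ys) + L *m ws - 2 *: (L *m xs))
    (col_mx (- (L *m xs)) (B *m ys)) = 0.
  rewrite -Mths thsE (ME _ erefl) /beta !add_col_mx addr0 /ys.
  rewrite (mulmxBr D^T _ b) (mulmxBr B _ b); congr col_mx.
  move: (D^T *m _) (D^T *m b) (L *m ws) (L *m xs) => u1 u2 u3 u4.
  by apply/matrixP => i j; rewrite !mxE; ring.
rewrite -[0]vsubmxK => /eq_col_mx[h1].
rewrite -[dsubmx 0]vsubmxK => /eq_col_mx[h2 h3].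
rewrite !linear0 in h1 h2 h3.
have Lxs : L *m xs = 0 by apply/eqP; rewrite -oppr_eq0 h2.
rewrite Lxs scaler0 subr0 addrC in h1.
split=> //.
- apply: dot_le0_eq0; rewrite dot_mull mulmxA Lxs dotC dot0l //.
- by apply/eqP; rewrite eq_sym -subr_eq0 h1.
split=> //; first by rewrite mulr_ge0 // addr_ge0 // ltW.
move=> t t0; have := hconv t t0; rewrite thsE /theta opp_col_mx add_col_mx.
rewrite opp_col_mx add_col_mx => hth.
have E0 : 0 <= C0 * expR (- alpha * t) by rewrite mulr_ge0 ?expR_ge0.
rewrite -mulrA; split.
  apply: (@le_trans _ _ (C0 * expR (- alpha * t))).
    apply: le_trans hth; rewrite dot_col_mx lerDl.
    exact: dot_ge0.
  by rewrite ler_peMl // lerDl ltW.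
have -> : y t - ys = row_mx D (row_mx 0 (- B^T)) *m
    col_mx (x t - xs) (col_mx (x t + z t - ws) (zeta t - zs)).
  rewrite !mul_row_col mul0mx add0r mulNmx !mulmxBr yE // /ys.
  move: (D *m _) (D *m _) (B^T *m _) (B^T *m _) => u1 u2 u3 u4.
  by apply/matrixP => i j; rewrite !mxE; ring.
apply: le_trans (hK' _) _; apply: (@le_trans _ _ (K' * (C0 * expR (- alpha * t)))).
  by rewrite ler_pM2l.
by rewrite ler_wpM2r // lerDr.
Qed.

End PrimalDualSystem.

(** * Operators, incidence and block matrices *)

Section AdjointOperators.
Variable R : realType.

(** Operators are plain maps between function spaces; possession of an adjoint forces linearity,
    which makes [mat F] represent [F]. *)
Definition adjoint (T U : finType) (F : (T -> R) -> U -> R) (F' : (U -> R) -> T -> R) :=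
  forall u v, \sum_b F u b * v b = \sum_a u a * F' v a.

Definition vec (T : finType) (u : T -> R) : 'cV[R]_#|T| := \col_a u (enum_val a).

Definition mat (T U : finType) (F : (T -> R) -> U -> R) : 'M[R]_(#|U|, #|T|) :=
  \matrix_(a, b) F (fun t => (t == enum_val b)%:R) (enum_val a).

Lemma vec_entries (T : finType) (w : 'cV[R]_#|T|) :
  vec (fun a => w (enum_rank a) 0) = w.
Proof. by apply/matrixP => i j; rewrite mxE enum_valK ord1. Qed.

Lemma vecK (T : finType) (u : T -> R) a : vec u (enum_rank a) 0 = u a.
Proof. by rewrite mxE enum_rankK. Qed.

Section Adjoint.
Variables (T U : finType) (F : (T -> R) -> U -> R) (F' : (U -> R) -> T -> R).
Hypothesis adjF : adjoint F F'.

Let sum_delta (S : finType) (f : S -> R) a : \sum_b f b * (b == a)%:R = f a.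
Proof.
by rewrite (bigD1 a) //= eqxx mulr1 big1 ?addr0 // => b /negbTE ->; rewrite mulr0.
Qed.

Let F_delta a b :
  F (fun t => (t == a)%:R) b = F' (fun t => (t == b)%:R) a.
Proof.
rewrite -(sum_delta (F _) b) adjF.
by under eq_bigr do rewrite mulrC; rewrite sum_delta.
Qed.

Lemma mat_vec u : mat F *m vec u = vec (F u).
Proof.
apply/matrixP => i j; rewrite ord1 !mxE.
under eq_bigr do rewrite !mxE F_delta mulrC.
rewrite -(sum_delta (F u) (enum_val i)) adjF.
by rewrite [RHS](reindex_onto enum_val enum_rank) => [|a _]; rewrite ?enum_rankK //=;
  apply: eq_bigl => a; rewrite enum_valK eqxx.
Qed.

Lemma tr_mat : (mat F)^T = mat F'.
Proof. by apply/matrixP => i j; rewrite !mxE F_delta. Qed.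

Lemma adjoint_sym : adjoint F' F.
Proof.
move=> u v; under eq_bigr do rewrite mulrC; rewrite -adjF.
by under eq_bigr do rewrite mulrC.
Qed.

End Adjoint.

Lemma mat_tr_vec (T U : finType) (F : (T -> R) -> U -> R) F' u :
  adjoint F F' -> (mat F)^T *m vec u = vec (F' u).
Proof. by move=> h; rewrite (tr_mat h) (mat_vec (adjoint_sym h)). Qed.

End AdjointOperators.

(** * Graph Laplacians factored through incidence operators *)

Section Incidence.
Variables (R : realType) (J : finType) (g : rel J).

(* The weight 1/sqrt 2 compensates that each edge occurs in both orientations. *)
Definition incidence (u : J -> R) (j k : J) : R :=
  Num.sqrt 2^-1 * (g j k)%:R * (u j - u k).

(** The transpose of [incidence]: a discrete divergence of edge variables. *)
Definition coincidence (v : J -> J -> R) (j : J) : R :=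
  Num.sqrt 2^-1 * \sum_k ((g j k)%:R * v j k - (g k j)%:R * v k j).

Lemma incidence_adjoint u v :
  \sum_j \sum_k incidence u j k * v j k = \sum_j u j * coincidence v j.
Proof.
rewrite /incidence /coincidence.
transitivity (Num.sqrt 2^-1 * (\sum_j \sum_k u j * ((g j k)%:R * v j k)
   - \sum_j \sum_k u k * ((g j k)%:R * v j k))).
  rewrite -sumrB mulr_sumr; apply: eq_bigr => j _.
  by rewrite -sumrB mulr_sumr; apply: eq_bigr => k _; ring.
rewrite [X in _ - X]exchange_big /= -sumrB mulr_sumr; apply: eq_bigr => j _.
rewrite -sumrB [RHS]mulrCA; congr (_ * _); rewrite mulr_sumr.
by apply: eq_bigr => k _; ring.
Qed.

(** Dual to the fact that [incidence] kills constants. It removes the Laplacian terms when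
    equilibrium equations are summed. *)
Lemma sum_coincidence v : \sum_j coincidence v j = 0.
Proof.
transitivity (\sum_j (fun=> 1) j * coincidence v j).
  by apply: eq_bigr => j _; rewrite mul1r.
rewrite -incidence_adjoint big1 // => j _; rewrite big1 // => k _.
by rewrite /incidence subrr mulr0 mul0r.
Qed.

Lemma coincidence_incidence u j : symmetric g ->
  coincidence (incidence u) j = \sum_(k | g j k) (u j - u k).
Proof.
move=> gs; rewrite /coincidence /incidence mulr_sumr [RHS]big_mkcond /=.
apply: eq_bigr => k _; rewrite (gs k j).
have h : Num.sqrt 2^-1 * Num.sqrt 2^-1 = 2^-1 :> R.
  by rewrite -expr2 sqr_sqrtr // invr_ge0.
case: (g j k) => /=; last by rewrite mulr0 !mul0r subrr mulr0.
transitivity (2 * (Num.sqrt 2^-1 * Num.sqrt 2^-1) * (u j - u k)); first by ring.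
by rewrite h divff // mul1r.
Qed.

(** Equality across each edge propagates along a path. *)
Lemma incidence_eq0_const u : connected_graph g ->
  (forall j k, incidence u j k = 0) -> forall j k, u j = u k.
Proof.
move=> gc h j k; have /connectP[p hp ->] := gc j k.
elim: p j hp => //= k' p ih j /andP[gjk hp]; rewrite -(ih _ hp).
have /eqP := h j k'; rewrite /incidence gjk mulr1 mulf_eq0 sqrtr_eq0.
by rewrite leNgt invr_gt0 ltr0n /= subr_eq0 => /eqP.
Qed.

End Incidence.

(** * Stacked blocks and row partitions of the identity *)

Lemma eq_colm (R : Type) k m q (p : 'I_k -> nat) (e : (\sum_(j < k) p j)%N = m)
    (v w : forall j, 'M[R]_(p j, q)) : (forall j, v j = w j) -> colm e v = colm e w.
Proof. by move=> h; rewrite /colm; congr castmx; exact: eq_mxcol. Qed.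

Section BlockStacks.
Variable R : realType.

Section Partition.
Variables (k m : nat) (p : 'I_k -> nat) (e : (\sum_(j < k) p j)%N = m).
Variable E : forall j, 'M[R]_(p j, m).
Hypothesis E1 : colm e E = 1%:M.

(** The stack of the [E j] is the identity, so its transpose may be inserted in front of the stack
    of the [v j]. *)
Lemma colm_sum q (v : forall j, 'M[R]_(p j, q)) :
  colm e v = \sum_j (E j)^T *m v j.
Proof.
move: E E1; case: m / e => F; rewrite /colm !castmx_id => F1.
by rewrite -mul_mxrow_mxcol -tr_mxcol F1 trmx1 mul1mx.
Qed.

Lemma partition_mul_colm q (v : forall j, 'M[R]_(p j, q)) j : E j *m colm e v = v j.
Proof.
move: E E1; case: m / e => F; rewrite /colm !castmx_id => F1.
by rewrite -(mxcolK F j) F1 submxcol_mul mul1mx mxcolK.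
Qed.

End Partition.

Lemma rowm_mul_colm k m n q (p : 'I_k -> nat) (e : (\sum_(j < k) p j)%N = n)
    (A : forall j, 'M[R]_(m, p j)) (v : forall j, 'M[R]_(p j, q)) :
  rowm e A *m colm e v = \sum_j A j *m v j.
Proof. by case: n / e; rewrite /rowm /colm !castmx_id mul_mxrow_mxcol. Qed.

Lemma tr_rowm_mul k m n q (p : 'I_k -> nat) (e : (\sum_(j < k) p j)%N = n)
    (A : forall j, 'M[R]_(m, p j)) (v : 'M[R]_(m, q)) :
  (rowm e A)^T *m v = colm e (fun j => (A j)^T *m v).
Proof. by case: n / e; rewrite /rowm /colm !castmx_id tr_mxrow mxcol_mul. Qed.

Lemma colm0 k n q (p : 'I_k -> nat) (e : (\sum_(j < k) p j)%N = n) :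
  colm e (fun j => 0 : 'M[R]_(p j, q)) = 0.
Proof. by case: n / e; rewrite /colm castmx_id mxcol0. Qed.

End BlockStacks.

(** * Convergence in coordinates *)

Section Convergence.
Variable R : realType.

(** Indexing by arbitrary finite types lets clusters of different dimensions enter through dependent
    pairs. *)
Lemma primal_dual_converges_fun (T U EC EB : finType)
    (D : (T -> R) -> U -> R) D' (C : (T -> R) -> EC -> R) C'
    (B : (U -> R) -> EB -> R) B' (b : U -> R)
    (x z : T -> R -> R) (xi y : U -> R -> R) :
  adjoint D D' -> adjoint C C' -> adjoint B B' ->
  (forall u (t : R), 0 <= t -> y u t = xi u t + D (x^~ t) u - b u) ->
  (forall a, derives (x a) (fun t =>
     - (D' (y^~ t) a - C' (C (z^~ t)) a) - C' (C (x^~ t)) a)) ->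
  (forall u, derives (xi u) (fun t => - B' (B (y^~ t)) u)) ->
  (forall a, derives (z a) (fun t => D' (y^~ t) a - C' (C (z^~ t)) a)) ->
  (forall u, xi u 0 = 0) ->
  exists xs ys ws zs C0 alpha, [/\ C xs =1 fun=> 0, B ys =1 fun=> 0,
    D' ys =1 C' (C ws), forall u, ys u = D xs u - B' zs u - b u &
    [/\ 0 <= C0, 0 < alpha &
    forall t : R, 0 <= t ->
      (forall a, (x a t - xs a) ^+ 2 <= C0 * expR (- alpha * t)) /\
      (forall u, (y u t - ys u) ^+ 2 <= C0 * expR (- alpha * t))]].
Proof.
move=> aD aC aB hy hx hxi hz xi0.
have vE (S : finType) (f df : S -> R -> R) (h : R -> 'cV_#|S|) :
    (forall a, derives (f a) (df a)) -> (forall t, h t = vec (df^~ t)) ->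
    vderives (fun t => vec (f^~ t)) h.
  move=> hf hh a; rewrite (_ : (fun t => _) = f (enum_val a)); last first.
    by apply/funext => t; rewrite mxE.
  by apply: derives_eq (hf _) _ => t _; rewrite hh mxE.
have [|||||xs [ys [ws [zs [C0 [alpha [h1 h2 h3 h4 [C00 alpha0 h5]]]]]]]] :=
  @primal_dual_converges R _ _ _ _ (mat D) (mat C) (mat B) (vec b)
    (fun t => vec (x^~ t)) (fun t => vec (z^~ t))
    (fun t => vec (xi^~ t)) (fun t => vec (y^~ t)).
- move=> t t0; rewrite (mat_vec aD); apply/matrixP => i j.
  by rewrite !mxE hy.
- apply: vE hx _ => t; rewrite -!mulmxA !(mat_vec aC) !(mat_tr_vec _ aC).
  by rewrite (mat_tr_vec _ aD); apply/matrixP => i j; rewrite !mxE.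
- apply: vE hxi _ => t; rewrite -!mulmxA (mat_vec aB) (mat_tr_vec _ aB).
  by apply/matrixP => i j; rewrite !mxE.
- apply: vE hz _ => t; rewrite -!mulmxA !(mat_vec aC) !(mat_tr_vec _ aC).
  by rewrite (mat_tr_vec _ aD); apply/matrixP => i j; rewrite !mxE.
- by apply/matrixP => i j; rewrite !mxE.
exists (fun a => xs (enum_rank a) 0), (fun u => ys (enum_rank u) 0),
  (fun a => ws (enum_rank a) 0), (fun u => zs (enum_rank u) 0), C0, alpha.
rewrite -(vec_entries xs) (mat_vec aC) in h1.
rewrite -(vec_entries ys) (mat_vec aB) in h2.
rewrite -(vec_entries ys) -(vec_entries ws) -mulmxA (mat_vec aC) in h3.
rewrite (mat_tr_vec _ aC) (mat_tr_vec _ aD) in h3.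
rewrite -(vec_entries xs) -(vec_entries zs) (mat_vec aD) (mat_tr_vec _ aB) in h4.
split.
- by move=> a; rewrite -vecK h1 mxE.
- by move=> a; rewrite -vecK h2 mxE.
- by move=> a; rewrite -vecK h3 vecK.
- by move=> u; rewrite {1}h4 !mxE !enum_rankK.
split=> // t t0; have [hxt hyt] := h5 t t0; split=> a.
  apply: le_trans hxt; have := sqr_entry_le_dot (vec (x^~ t) - xs) (enum_rank a).
  by rewrite !mxE enum_rankK.
apply: le_trans hyt; have := sqr_entry_le_dot (vec (y^~ t) - ys) (enum_rank a).
by rewrite !mxE enum_rankK.
Qed.

Lemma sqrt_decay (C0 alpha t : R) : 0 <= C0 ->
  Num.sqrt (C0 * expR (- alpha * t)) = Num.sqrt C0 * expR (- (alpha / 2) * t).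
Proof.
move=> C00; rewrite sqrtrM //; congr (_ * _).
rewrite (_ : - alpha * t = - (alpha / 2) * t + - (alpha / 2) * t); last by field.
by rewrite expRD -expr2 sqrtr_sqr ger0_norm ?expR_ge0.
Qed.

Lemma sqr_decay_cvg (f : R -> R) (l C0 alpha : R) : 0 <= C0 -> 0 < alpha ->
  (forall t : R, 0 <= t -> (f t - l) ^+ 2 <= C0 * expR (- alpha * t)) ->
  f t @[t --> +oo] --> l.
Proof.
move=> C00 alpha0 h.
have lim0 : Num.sqrt C0 * expR (- (alpha / 2) * t) @[t --> +oo] --> (0 : R).
  rewrite -[X in _ --> X](mulr0 (Num.sqrt C0)); apply: cvgM; first exact: cvg_cst.
  have a20 : 0 < alpha / 2 by rewrite divr_gt0.
  have h1 : alpha / 2 * t @[t --> +oo] --> +oo.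
    by apply: gt0_cvgMry => //; exact: cvg_id.
  have := cvg_comp _ _ h1 (@cvgr_expR R); apply: cvg_trans.
  by apply: near_eq_cvg; near=> t => /=; rewrite mulNr.
apply/cvgrPdist_lt => e e0.
near=> t.
have t0 : 0 <= t by near: t; exact: nbhs_pinfty_ge.
apply: (@le_lt_trans _ _ (Num.sqrt C0 * expR (- (alpha / 2) * t))).
  rewrite distrC -sqrtr_sqr -sqrt_decay // ler_wsqrtr //; exact: h.
near: t.
move/cvgrPdist_lt : lim0 => /(_ e e0); apply: filterS => t.
by rewrite sub0r normrN => /(le_lt_trans (ler_norm _)).
Unshelve. all: by end_near. Qed.

Lemma sqr_decay_converges k (f : R -> 'cV[R]_k) (l : 'cV[R]_k) (C0 alpha : R) :
  0 <= C0 -> 0 < alpha ->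
  (forall t : R, 0 <= t -> forall r, (f t r 0 - l r 0) ^+ 2 <= C0 * expR (- alpha * t)) ->
  converges_exponentially f l.
Proof.
(* The [k] squared entries add up, and the square root halves the rate. *)
move=> C00 alpha0 h; exists (Num.sqrt (k%:R * C0)), (alpha / 2).
split; [exact: sqrtr_ge0|by rewrite divr_gt0|] => t t0.
rewrite -sqrt_decay ?mulr_ge0 // /enorm ler_wsqrtr //.
rewrite -mulrA -[k in k%:R]card_ord -sum1_card natr_sum mulr_suml.
by apply: ler_sum => r _; rewrite mul1r !mxE; exact: h.
Qed.

Lemma cvg_mx_entries (F : set_system R) {FF : Filter F} m n
    (f : R -> 'M[R]_(m, n)) (l : 'M[R]_(m, n)) :
  (forall i j, f t i j @[t --> F] --> l i j) <-> (f t @[t --> F] --> l).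
Proof.
split=> [h|h i j]; last exact: (cvg_comp _ _ h (@coord_continuous _ _ _ i j l)).
apply/cvg_ballP => e e0.
have h' : \forall t \near F, forall ij : 'I_m * 'I_n, ball (l ij.1 ij.2) e (f t ij.1 ij.2).
  by apply: filter_forall => -[i j]; have /cvg_ballP := h i j; apply.
by apply: filterS h' => t ht; split => // i j; exact: (ht (i, j)).
Qed.

Lemma enorm_sqr k (v : 'cV[R]_k) : enorm v ^+ 2 = dot v v.
Proof.
rewrite /enorm sqr_sqrtr; last by apply: sumr_ge0 => a _; exact: sqr_ge0.
by apply: eq_bigr => a _; rewrite expr2.
Qed.

(** Pythagoras: the residual is orthogonal to the image of [A]. *)
Lemma normal_equation_least_square m n (A : 'M[R]_(m, n)) b x :
  A^T *m (A *m x - b) = 0 -> least_square_solution A b x.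
Proof.
move=> h x'; rewrite !enorm_sqr.
have -> : A *m x' - b = (A *m x - b) + A *m (x' - x).
  by rewrite mulmxBr [RHS]addrC subrKA.
move: (A *m x - b) h => rho h.
rewrite [leRHS]dotDl !dotDr (dotC _ rho) (dot_mulr _ rho) h dot0l addr0 add0r.
by rewrite lerDl dot_ge0.
Qed.

End Convergence.

(** * The double-layered network *)

Section LabelledIncidence.
Variable R : realType.

Lemma sum_sig (I : finType) (J : I -> finType) (F : {i : I & J i} -> R) :
  \sum_a F a = \sum_i \sum_(j : J i) F (Tagged J j).
Proof. by rewrite sig_big_dep; apply: eq_bigr => -[]. Qed.

Lemma sum_pair (I J : finType) (F : I * J -> R) :
  \sum_a F a = \sum_i \sum_j F (i, j).
Proof. by rewrite pair_bigA; apply: eq_bigr => -[]. Qed.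

(** Block-diagonal operators, used to treat the inner graphs of all clusters at once. *)
Lemma adjoint_sig (I : finType) (T U : I -> finType)
    (F : forall i, (T i -> R) -> U i -> R) (F' : forall i, (U i -> R) -> T i -> R) :
  (forall i, adjoint (F i) (F' i)) ->
  adjoint (fun (u : {i & T i} -> R) (b : {i & U i}) =>
             F (tag b) (fun a => u (Tagged T a)) (tagged b))
          (fun v a => F' (tag a) (fun b => v (Tagged U b)) (tagged a)).
Proof.
move=> h u v; rewrite !sum_sig; apply: eq_bigr => i _.
exact: (h i (fun a => u (Tagged T a)) (fun b => v (Tagged U b))).
Qed.

Variables (J Lab : finType) (g : rel J).

(** Kronecker product of [incidence] with the identity; labels stand for vector coordinates. *)
Definition label_incidence (u : J * Lab -> R) (e : J * J * Lab) : R :=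
  incidence g (fun j => u (j, e.2)) e.1.1 e.1.2.

Definition label_coincidence (v : J * J * Lab -> R) (a : J * Lab) : R :=
  coincidence g (fun j k => v (j, k, a.2)) a.1.

Lemma label_incidence_adjoint : adjoint label_incidence label_coincidence.
Proof.
move=> u v; rewrite sum_pair [RHS]sum_pair exchange_big [RHS]exchange_big.
apply: eq_bigr => r _; rewrite sum_pair.
exact: (incidence_adjoint g (fun j => u (j, r)) (fun j k => v (j, k, r))).
Qed.

Lemma label_coincidence_incidence (u : J * Lab -> R) j r : symmetric g ->
  label_coincidence (label_incidence u) (j, r) = \sum_(k | g j k) (u (j, r) - u (k, r)).
Proof. exact: (coincidence_incidence (fun j => u (j, r)) j). Qed.

End LabelledIncidence.

Theorem theorem2 (R : realType) (c m n : nat)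
  (s : 'I_c -> nat)                                  (* c_i *)
  (n_ : 'I_c -> nat)                                 (* n_i *)
  (m_ : forall i : 'I_c, 'I_(s i) -> nat)            (* m_ij *)
  (hn : (\sum_(i < c) n_ i)%N = n)
  (hm : forall i : 'I_c, (\sum_(j < s i) m_ i j)%N = m)
  (* data *)
  (A : 'M[R]_(m, n)) (b : 'cV[R]_m)
  (Ai : forall i : 'I_c, 'M[R]_(m, n_ i)) (bi : 'I_c -> 'cV[R]_m)
  (Aij : forall (i : 'I_c) (j : 'I_(s i)), 'M[R]_(m_ i j, n_ i))
  (bij : forall (i : 'I_c) (j : 'I_(s i)), 'cV[R]_(m_ i j))
  (Eij : forall (i : 'I_c) (j : 'I_(s i)), 'M[R]_(m_ i j, m))
  (hA : A = rowm hn Ai)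
  (hAi : forall i : 'I_c, Ai i = colm (hm i) (Aij i))
  (hb : b = \sum_(i < c) bi i)
  (hbi : forall i : 'I_c, bi i = colm (hm i) (bij i))
  (hE : forall i : 'I_c, colm (hm i) (Eij i) = 1%:M)
  (* graphs *)
  (G : rel 'I_c) (Gi : forall i : 'I_c, rel 'I_(s i))
  (hGu : undirected G) (hGc : connected_graph G)
  (hGiu : forall i : 'I_c, undirected (Gi i))
  (hGic : forall i : 'I_c, connected_graph (Gi i))
  (* trajectories *)
  (x z : forall (i : 'I_c) (j : 'I_(s i)), R -> 'cV[R]_(n_ i))
  (xi y : forall (i : 'I_c) (j : 'I_(s i)), R -> 'cV[R]_(m_ i j))
  (ybar : 'I_c -> R -> 'cV[R]_m)
  (hy : forall (i : 'I_c) (j : 'I_(s i)) (t : R), 0 <= t ->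
     y i j t = xi i j t + Aij i j *m x i j t - bij i j)
  (hybar : forall (k : 'I_c) (t : R), 0 <= t ->
     ybar k t = colm (hm k) (fun l : 'I_(s k) => y k l t))
  (hx : forall (i : 'I_c) (j : 'I_(s i)),
     derivative_on_nonneg (x i j) (fun t : R =>
       - ((Aij i j)^T *m y i j t - \sum_(k < s i | Gi i j k) (z i j t - z i k t))
       - \sum_(k < s i | Gi i j k) (x i j t - x i k t)))
  (hxi : forall (i : 'I_c) (j : 'I_(s i)),
     derivative_on_nonneg (xi i j) (fun t : R =>
       - \sum_(k < c | G i k) (y i j t - Eij i j *m ybar k t)))
  (hz : forall (i : 'I_c) (j : 'I_(s i)),
     derivative_on_nonneg (z i j) (fun t : R =>
       (Aij i j)^T *m y i j t - \sum_(k < s i | Gi i j k) (z i j t - z i k t)))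
  (hxi0 : forall (i : 'I_c) (j : 'I_(s i)), xi i j 0 = 0) :
  exists xlim : forall (i : 'I_c) (j : 'I_(s i)), 'cV[R]_(n_ i),
    (forall (i : 'I_c) (j : 'I_(s i)),
       converges_exponentially (x i j) (xlim i j)) /\
    exists xstar : forall i : 'I_c, 'cV[R]_(n_ i),
      [/\ (* (i) *)
          forall (i : 'I_c) (j : 'I_(s i)), xlim i j = xstar i,
          (* (ii) *)
          forall i : 'I_c,
            (Ai i)^T *m (\sum_(k < c) (Ai k *m xstar k - bi k)) = 0,
          least_square_solution A b (colm hn xstar) &
          A *m colm hn xstar = b <->
          ((\mxcol_(k < c) ybar k t) @[t --> +oo] --> (0 : 'cV[R]_(\sum_(k < c) m)))].
Proof.
(* [Ab i j] is [Aij i j] padded with zero rows to height [m]. Below, [T] indexes the entries of [x]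
   and [z], [U] those of the stacked [y] and [xi], and [EC] the edge variables inside clusters. *)
pose Ab i j : 'M[R]_(m, n_ i) := (Eij i j)^T *m Aij i j.
pose T := {i : 'I_c & ('I_(s i) * 'I_(n_ i))%type}.
pose U := ('I_c * 'I_m)%type.
pose EC := {i : 'I_c & ('I_(s i) * 'I_(s i) * 'I_(n_ i))%type}.
pose at_ (i : 'I_c) (j : 'I_(s i)) (r : 'I_(n_ i)) : T :=
  Tagged (fun i => ('I_(s i) * 'I_(n_ i))%type) (j, r).
pose D (u : T -> R) (q : U) : R :=
  \sum_j \sum_r Ab q.1 j q.2 r * u (at_ _ j r).
pose D' (v : U -> R) (a : T) : R :=
  \sum_p Ab (tag a) (tagged a).1 p (tagged a).2 * v (tag a, p).
have aD : adjoint D D'.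
  move=> u v; rewrite sum_pair sum_sig; apply: eq_bigr => i _; rewrite sum_pair /D /D' /=.
  under eq_bigr do rewrite mulr_suml.
  rewrite exchange_big; apply: eq_bigr => j _ /=.
  under eq_bigr do rewrite mulr_suml.
  rewrite exchange_big; apply: eq_bigr => r _ /=; rewrite mulr_sumr.
  by apply: eq_bigr => p _; rewrite [RHS]mulrCA mulrA.
have aC := adjoint_sig (fun i => @label_incidence_adjoint R _ 'I_(n_ i) (@Gi i)).
have aB := @label_incidence_adjoint R _ 'I_m G.
have yE i j (t : R) : 0 <= t -> Eij i j *m ybar i t = y i j t.
  by move=> t0; rewrite hybar // (partition_mul_colm (hE i)).
have ybarE i (t : R) : 0 <= t -> ybar i t = \sum_j (Eij i j)^T *m y i j t.
  by move=> t0; rewrite hybar // (colm_sum (hE i)).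
pose xibar i t := \sum_j (Eij i j)^T *m xi i j t.
pose X (a : T) t := x (tag a) (tagged a).1 t (tagged a).2 0.
pose Z (a : T) t := z (tag a) (tagged a).1 t (tagged a).2 0.
pose Xi (q : U) t := xibar q.1 t q.2 0.
pose Y (q : U) t := ybar q.1 t q.2 0.
have DE (v : forall i j, 'cV[R]_(n_ i)) i p :
    D (fun a => v (tag a) (tagged a).1 (tagged a).2 0) (i, p) =
    (\sum_j Ab i j *m v i j) p 0.
  by rewrite summxE; apply: eq_bigr => j _; rewrite mxE.
have D'E (v : 'I_c -> 'cV[R]_m) i j r :
    D' (fun q => v q.1 q.2 0) (at_ i j r) = ((Aij i j)^T *m (Eij i j *m v i)) r 0.
  rewrite mulmxA (_ : (Aij i j)^T *m Eij i j = (Ab i j)^T).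
    by rewrite mxE; apply: eq_bigr => p _; rewrite [in RHS]mxE.
  by rewrite /Ab trmx_mul trmxK.
have lapE (v : forall i, 'I_(s i) -> 'cV[R]_(n_ i)) i j r :
    (\sum_(k | Gi i j k) (v i j - v i k)) r 0 =
    label_coincidence (@Gi i) (label_incidence (@Gi i) (fun p => v i p.1 p.2 0)) (j, r).
  rewrite label_coincidence_incidence; last exact: hGiu.
  by rewrite summxE; apply: eq_bigr => k _; rewrite !mxE.
have entB k (u1 u2 : 'cV[R]_k) r : (u1 - u2) r 0 = u1 r 0 - u2 r 0 by rewrite !mxE.
have entN k (u1 : 'cV[R]_k) r : (- u1) r 0 = - u1 r 0 by rewrite !mxE.
have [|||||xs [ys [ws [zs [C0 [alpha [Cxs Bys D'ys ysE [C00 alpha0 hconv]]]]]]]] :=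
  @primal_dual_converges_fun R _ _ _ _ _ _ _ _ _ _ (fun q => bi q.1 q.2 0)
    X Z Xi Y aD aC aB.
- move=> [i p] t t0; rewrite (DE (fun i j => x i j t)) /Y /Xi /= ybarE // /xibar.
  rewrite hbi (colm_sum (hE i)) !summxE -big_split -sumrB.
  apply: eq_bigr => j _; rewrite hy // /Ab mulmxBr mulmxDr mulmxA.
  by rewrite [LHS]mxE [in LHS]mxE [X in _ + X]mxE.
- move=> [i [j r]].
  apply: derives_eq (derivative_on_nonneg_vderives (hx i j) r) _ => t t0.
  rewrite entB entN entB; congr (- (_ - _) - _).
  + by rewrite -yE ?ltW // -(D'E (ybar^~ t)).
  + exact: (lapE (fun i j => z i j t)).
  + exact: (lapE (fun i j => x i j t)).
- move=> [i p].
  have h j := vderives_mul (Eij i j)^T (derivative_on_nonneg_vderives (hxi i j)).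
  apply: derives_eq (vderives_sum h p) _ => t t0.
  (* Summing against the transposed [Eij] reassembles the agents' equations into the cluster
     Laplacian acting on [ybar]. *)
  have -> : \sum_j (Eij i j)^T *m - (\sum_(k | G i k) (y i j t - Eij i j *m ybar k t)) =
      - \sum_(k | G i k) (ybar i t - ybar k t).
    under eq_bigr do rewrite mulmxN mulmx_sumr.
    rewrite sumrN exchange_big; congr (- _); apply: eq_bigr => k _.
    under eq_bigr do rewrite mulmxBr mulmxA.
    rewrite sumrB -ybarE ?ltW // -mulmx_suml -(colm_sum (hE i)) hE mul1mx //.
  rewrite entN label_coincidence_incidence // summxE; congr (- _).
  by apply: eq_bigr => k _; rewrite entB.
- move=> [i [j r]].
  apply: derives_eq (derivative_on_nonneg_vderives (hz i j) r) _ => t t0.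
  rewrite entB; congr (_ - _).
  + by rewrite -yE ?ltW // -(D'E (ybar^~ t)).
  + exact: (lapE (fun i j => z i j t)).
- move=> [i p]; rewrite /Xi /xibar summxE big1 // => j _.
  by rewrite hxi0 mulmx0 mxE.
pose xlim i j : 'cV[R]_(n_ i) := \col_r xs (at_ i j r).
(* Any agent may be picked, by consensus; the default 0 concerns a cluster without agents, for which
   [Ai i] is an empty sum. *)
pose xstar i : 'cV[R]_(n_ i) := if [pick j : 'I_(s i)] is Some j then xlim i j else 0.
have xlimE i j : xlim i j = xstar i.
  rewrite /xstar; case: pickP => [j0 _|/(_ j)//].
  apply/matrixP => r q; rewrite !mxE.
  exact: (incidence_eq0_const (u := fun j => xs (at_ i j r)) (@hGic i)
    (fun j k => Cxs (Tagged _ (j, k, r)))).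
pose ysb i : 'cV[R]_m := \col_p ys (i, p).
have ysb_const i k : ysb i = ysb k.
  apply/matrixP => p q; rewrite !mxE.
  exact: (incidence_eq0_const (u := fun i => ys (i, p)) hGc
    (fun j k => Bys (j, k, p))).
have AiE i : Ai i = \sum_j Ab i j by rewrite hAi (colm_sum (hE i)).
pose rho := \sum_k (Ai k *m xstar k - bi k).
(* Summed over the clusters, the [zs] term vanishes by [sum_coincidence]. *)
have rhoE : rho = \sum_k ysb k.
  apply/matrixP => p q; rewrite ord1 !summxE.
  transitivity (\sum_k (ys (k, p) + label_coincidence G zs (k, p))); last first.
    by rewrite big_split /= sum_coincidence addr0; apply: eq_bigr => k _; rewrite mxE.
  apply: eq_bigr => k _; rewrite ysE addrAC subrK entB; congr (_ - _).
  rewrite AiE mulmx_suml summxE; apply: eq_bigr => j _.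
  by rewrite -(xlimE k j) mxE; apply: eq_bigr => r _; rewrite [xlim _ _ _ _]mxE.
have rho_ysb i : rho = c%:R *: ysb i.
  rewrite rhoE (eq_bigr (fun=> ysb i)) => [|k _]; last exact: ysb_const.
  by rewrite sumr_const card_ord scaler_nat.
(* Consensus reduces [rho] to a multiple of [ysb i]; summing [D'ys] over the agents of cluster [i]
   cancels the inner Laplacian. *)
have tr_Ai_rho i : (Ai i)^T *m rho = 0.
  rewrite (rho_ysb i) -scalemxAr AiE linear_sum /= mulmx_suml.
  suff -> : \sum_j (Ab i j)^T *m ysb i = 0 by rewrite scaler0.
  apply/matrixP => r q; rewrite ord1 summxE mxE.
  transitivity (\sum_j D' ys (at_ i j r)).
    by apply: eq_bigr => j _; rewrite mxE; apply: eq_bigr => p _; rewrite !mxE.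
  by under eq_bigr do rewrite D'ys; exact: sum_coincidence.
have AxE : A *m colm hn xstar - b = rho.
  by rewrite hA rowm_mul_colm hb /rho sumrB.
exists xlim; split.
  move=> i j; apply: (sqr_decay_converges C00 alpha0) => t t0 r.
  by have [/(_ (at_ i j r)) h _] := hconv t t0; rewrite [xlim _ _ _ _]mxE.
exists xstar; split=> //.
- apply: normal_equation_least_square.
  by rewrite AxE hA tr_rowm_mul (eq_colm _ tr_Ai_rho) colm0.
have Ycvg i p : ybar i t p 0 @[t --> +oo] --> ys (i, p).
  apply: (sqr_decay_cvg C00 alpha0) => t t0.
  by have [_ /(_ (i, p))] := hconv t t0.
have mxcol_entry (v : 'I_c -> 'cV[R]_m) i p :
    (\mxcol_k v k) (@tagnat.Rank _ (fun=> m) i p) 0 = v i p 0.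
  by have /matrixP/(_ p 0) := mxcolK v i; rewrite mxE.
(* Forward, [rho = c%:R *: ysb i] with [c] positive, as an index [i] exists; backward, uniqueness of
   limits gives [ys = 0], hence [rho = 0]. *)
split=> [Axb|h].
  have rho0 : rho = 0 by rewrite -AxE Axb subrr.
  have ys0 i p : ys (i, p) = 0.
    have c_gt0 : (0 < c)%N by apply: leq_ltn_trans (ltn_ord i).
    have /eqP := rho_ysb i; rewrite rho0 eq_sym scaler_eq0 pnatr_eq0.
    rewrite (gtn_eqF c_gt0) /=.
    by move=> /eqP/matrixP/(_ p 0); rewrite !mxE.
  apply/cvg_mx_entries => a q; rewrite ord1 mxE.
  rewrite (_ : (fun t => _) = fun t => ybar (tagnat.sig1 a) t (tagnat.sig2 a) 0).
    by rewrite -(ys0 (tagnat.sig1 a) (tagnat.sig2 a)); exact: Ycvg.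
  by apply/funext => t; rewrite mxE.
have ys0 q : ys q = 0.
  case: q => i p; apply: (cvg_unique _ (Ycvg i p)) => //.
  have /cvg_mx_entries/(_ (@tagnat.Rank _ (fun=> m) i p) 0) := h; rewrite mxE.
  by under eq_fun do rewrite mxcol_entry.
apply/eqP; rewrite -subr_eq0 AxE rhoE big1 // => k _.
by apply/matrixP => p q; rewrite !mxE ys0.
Qed.
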